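(* Let $d\ge 2$ and let $X$ and $Y$ be $\mathbb{R}^d$ equipped with (possibly different) quasi-norms. For all natural numbers $k\ge 1$, $$ e_k(\mathbb{S}_X,Y)\;\ge\;\max_{1\le i\le d} e_k(B_{X^i},Y^i). $$
   Context: $B_X$ and $\mathbb{S}_X$ denote the closed unit ball and the unit sphere $\{x:\|x\|_X=1\}$ of $X$ (similarly for $Y$). For $1\le i\le d$, $H_i\subset\mathbb{R}^d$ is the hyperplane of vectors whose $i$-th coordinate equals $0$. $X^i$ denotes the hyperplane $H_i$ equipped with the quasi-norm whose unit ball $B_{X^i}$ is the image of $B_X$ under the (Euclidean) orthogonal projection of $\mathbb{R}^d$ onto $H_i$; $Y^i$ is defined in the same way from $Y$. For a subset $K$ of a finite-dimensional (quasi-)Banach space $Z$ with closed unit ball $B_Z$, and $k\in\mathbb{N}$, $k\ge1$, the $k$-th (dyadic) entropy number is $$e_k(K,Z)=\min\Big\{\varepsilon>0: K\subset\bigcup_{j=1}^{2^{k-1}}(x_j+\varepsilon B_Z)\text{ for some }x_1,\dots,x_{2^{k-1}}\in Z\Big\}.$$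
   Formalization: The quasi-norm of X is additionally assumed continuous; for discontinuous quasi-norms the inequality can fail (e.g. d = 2, k = 3), even when the unit ball of X is closed. The entropy number is taken as an infimum, which equals the minimum whenever that exists. *)

(* Defs.v *)
From HB Require Import structures.
From mathcomp Require Import all_boot all_order all_algebra.
From mathcomp Require Import all_classical all_reals all_analysis.

Set Implicit Arguments.
Unset Strict Implicit.
Unset Printing Implicit Defensive.

Import Order.TTheory GRing.Theory Num.Theory.
Import numFieldNormedType.Exports.
Local Open Scope classical_set_scope.
Local Open Scope ring_scope.

(** No continuity is built in: a quasi-norm on R^d is bounded above and below by
    multiples of the Euclidean norm, but it need not be continuous, even when its
    unit ball is closed; without continuity a line meeting the unit ball can miss
    the unit sphere. *)
Definition quasi_norm (R : realType) (V : lmodType R) (N : V -> R) : Prop :=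
  [/\ forall x, 0 <= N x,
      forall x, N x = 0 -> x = 0,
      forall (a : R) x, N (a *: x) = `|a| * N x &
      exists C : R, forall x y, N (x + y) <= C * (N x + N y)].

Definition unit_ball (R : realType) (V : lmodType R) (N : V -> R) : set V :=
  [set x | N x <= 1].

Definition unit_sphere (R : realType) (V : lmodType R) (N : V -> R) : set V :=
  [set x | N x = 1].

(** [Z] is the underlying set of the space and [B] its unit ball. Both lie in an
    ambient vector space [V], so that a hyperplane of [V] is a possible [Z]; the
    centres of the balls are then required to lie in that hyperplane. *)
Definition entropy_cover (R : realType) (V : lmodType R) (Z B K : set V)
    (k : nat) : set R :=
  [set eps | 0 < eps /\
    exists c : 'I_(2 ^ k.-1) -> V, (forall j, Z (c j)) /\
      K `<=` \bigcup_(j in setT) [set c j + eps *: b | b in B]].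

Definition entropy_number (R : realType) (V : lmodType R) (Z B K : set V)
    (k : nat) : R :=
  inf (entropy_cover Z B K k).

(** The infimum is the minimum as soon as the latter exists. *)
Lemma entropy_number_min (R : realType) (V : lmodType R) (Z B K : set V)
    (k : nat) (eps : R) :
  entropy_cover Z B K k eps -> lbound (entropy_cover Z B K k) eps ->
  entropy_number Z B K k = eps.
Proof.
move=> he hl; apply/eqP; rewrite eq_le; apply/andP; split.
  by apply: ge_inf => //; exists eps.
by apply: lb_le_inf => //; exists eps.
Qed.

(** Hence [0] is a neutral default value for a finite maximum of entropy numbers. *)
Lemma entropy_number_ge0 (R : realType) (V : lmodType R) (Z B K : set V)
    (k : nat) : 0 <= entropy_number Z B K k.
Proof.
rewrite /entropy_number; have [h|h] := pselect (has_inf (entropy_cover Z B K k)).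
  by apply: lb_le_inf => [|e [/ltW]]; case: h.
by rewrite inf_out.
Qed.

Definition hyperplane (R : realType) (d : nat) (i : 'I_d) : set 'rV[R]_d :=
  [set x | x 0 i = 0].

Definition proj (R : realType) (d : nat) (i : 'I_d) (x : 'rV[R]_d) : 'rV[R]_d :=
  x - x 0 i *: delta_mx 0 i.

Lemma proj_hyperplane (R : realType) (d : nat) (i : 'I_d) (x : 'rV[R]_d) :
  hyperplane i (proj i x).
Proof. by rewrite /hyperplane /proj /= !mxE !eqxx mulr1 subrr. Qed.

Lemma proj_orthogonal (R : realType) (d : nat) (i : 'I_d) (x y : 'rV[R]_d) :
  hyperplane i y -> (x - proj i x) *m y^T = 0.
Proof.
rewrite /hyperplane /proj /= => hy.
rewrite opprB addrC subrK -scalemxAl -rowE.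
by apply/rowP => j; rewrite !mxE !ord1 hy mulr0.
Qed.

(** The hyperplane with the projected quasi-norm is represented by its underlying
    set [hyperplane i] and its unit ball [proj_ball i N]. *)
Definition proj_ball (R : realType) (d : nat) (i : 'I_d) (N : 'rV[R]_d -> R) :
    set 'rV[R]_d :=
  proj i @` unit_ball N.

(* Main.v *)
Require Import Defs.
From HB Require Import structures.
From mathcomp Require Import all_boot all_order all_algebra.
From mathcomp Require Import all_classical all_reals all_analysis.

Set Implicit Arguments.
Unset Strict Implicit.
Unset Printing Implicit Defensive.

Import Order.TTheory GRing.Theory Num.Theory.
Import numFieldNormedType.Exports.
Local Open Scope classical_set_scope.
Local Open Scope ring_scope.

(** The idea is that the projection along the [i]-th axis maps the unit sphere of
    [X] onto the whole projected unit ball of [X]: a line through a point of the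
    ball leaves every bounded set, so by the intermediate value theorem it meets
    the sphere ([unit_sphere_meets_line]).  Since the projection is linear and maps
    the unit ball of [Y] onto the unit ball of [Y^i], the projection of a cover of
    the sphere by balls of radius [eps] of [Y] is a cover of the projected ball of
    [X] by balls of radius [eps] of [Y^i] ([entropy_cover_proj]).  So every radius
    admissible for the sphere is admissible for the projected ball.

    This inclusion yields the inequality between the infima only when the smaller
    set is nonempty, an infimum over the empty set being [0] by convention.
    Hence the sphere must also be shown to have some finite cover, that is, to be
    bounded in [Y] ([unit_sphere_bounded]).  For this both quasi-norms are compared
    with the sup norm: a quasi-norm is bounded above by a multiple of it, by
    expanding vectors in the canonical basis, and a continuous one is bounded below
    by a positive multiple of it, by compactness of the sup-norm sphere. *)

Section QuasiNorm.
Variables (R : realType) (V : lmodType R) (N : V -> R).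
Hypothesis hN : quasi_norm N.

Lemma quasi_norm_ge0 x : 0 <= N x.
Proof. by case: hN. Qed.

Lemma quasi_normZ (a : R) x : N (a *: x) = `|a| * N x.
Proof. by case: hN. Qed.

Lemma quasi_norm0 : N 0 = 0.
Proof. by rewrite -(scale0r 0) quasi_normZ normr0 mul0r. Qed.

Lemma quasi_normN x : N (- x) = N x.
Proof. by rewrite -scaleN1r quasi_normZ normrN1 mul1r. Qed.

Lemma quasi_norm_gt0 x : x != 0 -> 0 < N x.
Proof.
move=> x0; rewrite lt_neqAle quasi_norm_ge0 andbT eq_sym.
by apply: contra x0 => /eqP; case: hN => _ N0 _ _ /N0 ->.
Qed.

Lemma quasi_norm_triangle :
  exists2 C : R, 0 < C & forall x y, N (x + y) <= C * (N x + N y).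
Proof.
have [_ _ _ [C hC]] := hN; exists (`|C| + 1) => [|x y].
  by rewrite ltr_wpDl.
apply: (le_trans (hC x y)); apply: ler_wpM2r; first by rewrite addr_ge0 ?quasi_norm_ge0.
by rewrite (le_trans (ler_norm C)) // lerDl.
Qed.

(** By induction on the number of terms, each sum costing one more factor of the
    triangle constant; the bound is uniform in the coefficients. *)
Lemma quasi_norm_sum_le (I : Type) (s : seq I) (v : I -> V) :
  exists2 M : R, 0 <= M & forall (a : I -> R) (r : R),
    (forall i, `|a i| <= r) -> N (\sum_(i <- s) a i *: v i) <= r * M.
Proof.
have [C C0 hC] := quasi_norm_triangle.
elim: s => [|i s [M M0 hM]].
  by exists 0 => // a r _; rewrite big_nil quasi_norm0 mulr0.
exists (C * (N (v i) + M)) => [|a r ar].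
  by rewrite mulr_ge0 ?addr_ge0 ?quasi_norm_ge0 // ltW.
rewrite big_cons (le_trans (hC _ _)) // mulrCA ler_pM2l // mulrDr lerD ?hM //.
by rewrite quasi_normZ ler_wpM2r ?quasi_norm_ge0.
Qed.

(** The quasi-norm of [x + t *: e] tends to infinity with [t] because it controls
    that of [t *: e] through the quasi-triangle inequality; if it is at most [1]
    at [t = 0], it therefore takes the value [1] in between. *)
Lemma unit_sphere_meets_line (x e : V) :
  e != 0 -> continuous (fun t : R => N (x + t *: e)) -> N x <= 1 ->
  exists t : R, N (x + t *: e) = 1.
Proof.
move=> e0 cf x1; have Ne := quasi_norm_gt0 e0.
have [C C0 hC] := quasi_norm_triangle.
(* chosen so that t * N e = 2 * C, the value of C * (N (x + t *: e) + N x) when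
   both quasi-norms are 1 *)
pose t := C * 2 / N e.
have t0 : 0 <= t by rewrite divr_ge0 ?mulr_ge0 // ltW.
have far : 1 <= N (x + t *: e).
  have := hC (x + t *: e) (- x).
  rewrite addrC addKr quasi_normZ quasi_normN (ger0_norm t0) divfK ?gt_eqF //.
  rewrite ler_pM2l // => h.
  by rewrite -(lerD2r 1) (le_trans h) // lerD2l.
have [|s _ hs] := @IVT R (fun s => N (x + s *: e)) 0 t 1 t0 (continuous_subspaceT cf).
  by rewrite scale0r addr0 ge_min le_max x1 far orbT.
by exists s.
Qed.

End QuasiNorm.

Section CompareWithSupNorm.
Variables (R : realType) (d : nat) (N : 'rV[R]_d -> R).
Hypothesis hN : quasi_norm N.

Lemma quasi_norm_le_norm :
  exists2 M : R, 0 <= M & forall x, N x <= `|x| * M.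
Proof.
have [M M0 hM] := quasi_norm_sum_le hN (index_enum 'I_d) (fun i => delta_mx 0 i).
exists M => // x; rewrite {1}[x]row_sum_delta; apply: hM => i.
rewrite [leRHS]mx_normrE.
exact: (le_bigmax _ (fun ij : 'I_1 * 'I_d => `|x ij.1 ij.2|) (0, i)).
Qed.

(** Compactness of the sup-norm sphere gives a positive minimum of [N] there, and
    homogeneity extends the bound to all vectors. *)
Lemma norm_le_quasi_norm :
  continuous N -> exists2 m : R, 0 < m & forall x, m * `|x| <= N x.
Proof.
move=> cN; pose S : set 'rV[R]_d := [set x | `|x| = 1].
(* the sphere is empty exactly when d = 0 *)
have [S0|S0] := pselect (S !=set0); last first.
  exists 1 => // x; have [->|x0] := eqVneq x 0.
    by rewrite normr0 mulr0 quasi_norm_ge0.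
  case: S0; exists (`|x|^-1 *: x).
  by rewrite /S /= normrZ normfV normr_id mulVf // normr_eq0.
have cS : compact S.
  apply: bounded_closed_compact.
    by exists 1; split => // r r1 x /= ->; apply: ltW.
  rewrite (_ : S = (fun x => `|x|) @^-1` [set 1]) //.
  by apply: closed_comp => // x _; apply: norm_continuous.
have [c cS1 hc] := EVT_min_rV S0 cS (continuous_subspaceT cN).
have c1 : `|c| = 1 by move: cS1; rewrite inE.
exists (N c) => [|x].
  by apply: quasi_norm_gt0 => //; rewrite -normr_eq0 c1 oner_eq0.
have [->|x0] := eqVneq x 0.
  by rewrite normr0 mulr0 quasi_norm_ge0.
have nx0 : `|x| != 0 by rewrite normr_eq0.
have : N c <= N (`|x|^-1 *: x).
  by apply: hc; rewrite inE /S /= normrZ normfV normr_id mulVf.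
rewrite quasi_normZ // normfV normr_id mulrC ler_pdivlMr //.
by rewrite lt_neqAle eq_sym nx0 normr_ge0.
Qed.

End CompareWithSupNorm.

Lemma unit_sphere_bounded (R : realType) (d : nat) (NX NY : 'rV[R]_d -> R) :
  quasi_norm NX -> continuous NX -> quasi_norm NY ->
  exists2 M : R, 0 < M & forall x, unit_sphere NX x -> NY x <= M.
Proof.
move=> hX cX hY.
have [m m0 hm] := norm_le_quasi_norm hX cX.
have [M M0 hM] := quasi_norm_le_norm hY.
exists (m^-1 * M + 1) => [|x x1].
  by rewrite ltr_wpDl // mulr_ge0 // invr_ge0 ltW.
rewrite (le_trans (hM x)) // ler_wpDr // ler_wpM2r //.
by rewrite -[m^-1]mulr1 ler_pdivlMl // -[leRHS]x1 hm.
Qed.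

(** The entropy number of a bounded set is an infimum over a nonempty set of radii,
    and not the default value [0]: a single ball centred at the origin suffices. *)
Lemma entropy_cover_bounded (R : realType) (V : lmodType R) (N : V -> R)
    (Z K : set V) (k : nat) (M : R) :
  quasi_norm N -> Z 0 -> 0 < M -> (forall x, K x -> N x <= M) ->
  entropy_cover Z (unit_ball N) K k M.
Proof.
move=> hN Z0 M0 hK; split=> //; exists (fun=> 0); split=> // x Kx.
have k0 : (0 < 2 ^ k.-1)%N by rewrite expn_gt0.
exists (Ordinal k0) => //; exists (M^-1 *: x).
  rewrite /unit_ball /= quasi_normZ // gtr0_norm ?invr_gt0 //.
  by rewrite ler_pdivrMl // mulr1 hK.
by rewrite add0r scalerA divff ?scale1r // gt_eqF.
Qed.

Lemma projD (R : realType) (d : nat) (i : 'I_d) (x y : 'rV[R]_d) :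
  Defs.proj i (x + y) = Defs.proj i x + Defs.proj i y.
Proof. by rewrite /Defs.proj !mxE scalerDl opprD addrACA. Qed.

Lemma projZ (R : realType) (d : nat) (i : 'I_d) (a : R) (x : 'rV[R]_d) :
  Defs.proj i (a *: x) = a *: Defs.proj i x.
Proof. by rewrite /Defs.proj !mxE scalerBr scalerA. Qed.

Lemma proj_axis (R : realType) (d : nat) (i : 'I_d) :
  Defs.proj i (delta_mx 0 i : 'rV[R]_d) = 0.
Proof. by rewrite /Defs.proj !mxE !eqxx scale1r subrr. Qed.

(** The point of the sphere is sought on the fibre of the projection, a line parallel
    to the [i]-th axis. *)
Lemma proj_ball_sub_proj_sphere (R : realType) (d : nat) (i : 'I_d)
    (N : 'rV[R]_d -> R) :
  quasi_norm N -> continuous N -> proj_ball i N `<=` Defs.proj i @` unit_sphere N.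
Proof.
move=> hN cN _ [x x1 <-].
have e0 : (delta_mx 0 i : 'rV[R]_d) != 0.
  apply/eqP => /rowP /(_ i); rewrite !mxE !eqxx.
  exact/eqP/oner_neq0.
have cline : continuous (fun t : R => N (x + t *: delta_mx 0 i)).
  move=> t; apply: continuous_comp; last exact: cN.
  by apply: cvgD; [exact: cvg_cst | apply: cvgZr_tmp; exact: cvg_id].
have [t ht] := unit_sphere_meets_line hN e0 cline x1.
exists (x + t *: delta_mx 0 i) => //.
by rewrite projD projZ proj_axis scaler0 addr0.
Qed.

(** By linearity the projection of a translated and dilated copy of [B] is the same
    copy of the projection of [B], with the same radius and a centre in the
    hyperplane. *)
Lemma entropy_cover_proj (R : realType) (d : nat) (i : 'I_d)
    (B K K' : set 'rV[R]_d) (k : nat) (eps : R) :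
  K' `<=` Defs.proj i @` K -> entropy_cover setT B K k eps ->
  entropy_cover (hyperplane i) (Defs.proj i @` B) K' k eps.
Proof.
move=> sub [eps0 [c [_ cov]]]; split=> //.
exists (fun j => Defs.proj i (c j)); split=> [j|y /sub[x Kx <-]].
  exact: proj_hyperplane.
have [j _ [b Bb <-]] := cov _ Kx.
by exists j => //; exists (Defs.proj i b); [exists b | rewrite projD projZ].
Qed.

(** Nonemptiness of the smaller set of radii cannot be dropped: over the empty set
    the infimum is [0], whatever the larger one. *)
Lemma entropy_number_le (R : realType) (V : lmodType R)
    (Z B K Z' B' K' : set V) (k k' : nat) :
  entropy_cover Z B K k !=set0 ->
  entropy_cover Z B K k `<=` entropy_cover Z' B' K' k' ->
  entropy_number Z' B' K' k' <= entropy_number Z B K k.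
Proof.
move=> ne sub; apply: lb_le_inf => // eps /sub heps.
by apply: ge_inf => //; exists 0 => r [/ltW].
Qed.

Theorem theorem9 (R : realType) (d : nat) (NX NY : 'rV[R]_d -> R)
    (hd : (2 <= d)%N)
    (hX : quasi_norm NX) (cX : continuous NX) (hY : quasi_norm NY)
    (k : nat) (hk : (1 <= k)%N) :
  entropy_number setT (unit_ball NY) (unit_sphere NX) k >=
  \big[Num.max/0]_(i < d)
    entropy_number (hyperplane i) (proj_ball i NY) (proj_ball i NX) k.
Proof.
apply: bigmax_le => [|i _]; first exact: entropy_number_ge0.
apply: entropy_number_le => [|eps].
  have [M M0 hM] := unit_sphere_bounded hX cX hY.
  by exists M; apply: entropy_cover_bounded.
exact/entropy_cover_proj/proj_ball_sub_proj_sphere.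
Qed.
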